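(* Let $c$ be a closed planar cross-section in the $XZ$-plane that is a $C^0$-continuous finite composition of at least $C^1$-smooth curve segments, considered in a state of the T-type deformation in which it has no point with a horizontal tangent. Suppose there exists an admissible decomposition of $c$ into curve segments such that the following holds. Curve segments that are related, up to translation, in one of the following four ways belong to the same class: (i) they are identical; (ii) they are reflection symmetric with respect to the $X$-axis; (iii) they are reflection symmetric with respect to the $Z$-axis; (iv) they are related by a $180^\circ$ rotation. Run through $c$ counter-clockwise, starting from an arbitrary break point, and for each curve segment $c_i$ of the decomposition set $\mathrm{sign}(c_i)=+1$ if $c_i$ is strictly monotonically increasing (in the $Z$-coordinate) during the sweep and $\mathrm{sign}(c_i)=-1$ if it is strictly monotonically decreasing. For each class, the sum of $\mathrm{sign}(c_i)$ over all curve segments $c_i$ in the class is zero. Then $c$ is compatible with the isometric deformations of T-type.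
   Context: Admissible decomposition: for a cross-section $c$ that is a $C^0$-continuous finite composition of at least $C^1$-smooth curve segments, an admissible decomposition is obtained by introducing a finite set of break points that contains at least all points with either (a) a $C^1$ discontinuity or (b) a vertical tangent (parallel to the $Z$-axis). If $c$ contains a vertical line-segment, then both of its end points are break points but not the points in between. The curve segments of the decomposition are the arcs between consecutive break points. Smooth and semi-discrete T-surfaces are the analogs of T-hedra. A T-hedron is generated from a profile polyline in a vertical plane and a trajectory polyline in the horizontal base plane (the $XY$-plane) by successive parallel projections of the profile into further vertical planes, in the directions of the trajectory edges. In the smooth or semi-discrete case the profile and/or the trajectory (together with the polygon enveloped by the vertical planes in the base plane) are replaced by smooth curves. Tubes are obtained when the profile (cross-section) is closed. The T-type isometric deformation of such a surface is a one-parameter family with parameter $t$ (varying within the flexion limits). It acts on the profile in the $XZ$-plane as follows: a curve segment with arc-length parametrization $(f(s),0,g(s))$, starting at the origin, is transformed into $$\left(t f(s),\,0,\,\int_0^{s}\varepsilon\sqrt{(1-t^2)f'(\sigma)^2+g'(\sigma)^2}\,d\sigma\right),$$ where $\varepsilon=\pm1$ is the sign of $g'$ on the segment (increasing or decreasing), fixed throughout the deformation. The value $t=1$ gives the initial state, $t$ is such that the radicands are nonnegative, and the deformed segments of a cross-section are concatenated in the original order. A closed cross-section is compatible with the isometric deformations of T-type if it remains closed under this deformation, i.e. its deformed start and end points coincide for all admissible $t$. Standing assumption: without loss of generality there exists a state of deformation in which the profile has no horizontal tangent, since a horizontal tangent corresponds to a flexion limit. *)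

(* Defs.v *)
(* Stdlib reals with Coquelicot. *)
From Stdlib Require Import Reals ZArith List ClassicalEpsilon.
From Coquelicot Require Import Coquelicot.
Local Open Scope R_scope.

(* [p 0 < ... < p n] cut one period of a closed curve of length [L]; the first
   break point is arbitrary. *)
Definition partition (L : R) (n : nat) (p : nat -> R) : Prop :=
  p n = p 0%nat + L /\ forall i, (i < n)%nat -> p i < p (S i).

(* C^1 up to the end points: restriction of a C^1 function on the line. *)
Definition C1_on (f : R -> R) (a b : R) : Prop :=
  exists F : R -> R,
    (forall s, ex_derive F s /\ continuous (Derive F) s) /\
    (forall s, a <= s <= b -> f s = F s).

(* A closed curve s |-> (cx s, 0, cz s) in the XZ-plane, extended periodically
   with its length as period, so that no parameter value plays a special role.
   It is not assumed to be simple. *)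
Record closed_cross_section := ClosedCrossSection {
  cx : R -> R;
  cz : R -> R;
  clen : R;
  cnum : nat;
  cbrk : nat -> R;
  clen_gt0 : 0 < clen;
  cx_periodic : forall s, cx (s + clen) = cx s;
  cz_periodic : forall s, cz (s + clen) = cz s;
  c_continuous : forall s, continuous cx s /\ continuous cz s;
  cbrk_partition : partition clen cnum cbrk;
  c_piecewise_C1 : forall i, (i < cnum)%nat ->
    C1_on cx (cbrk i) (cbrk (S i)) /\ C1_on cz (cbrk i) (cbrk (S i));
  c_arc_length : forall i s, (i < cnum)%nat -> cbrk i < s < cbrk (S i) ->
    (Derive cx s) ^ 2 + (Derive cz s) ^ 2 = 1
}.

(* Both one-sided tangents count at the points where the curve is not C^1. *)
Definition horizontal_tangent (c : closed_cross_section) (s : R) : Prop :=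
  filterlim (fun h => (cz c (s + h) - cz c s) / h) (at_left 0) (locally 0) \/
  filterlim (fun h => (cz c (s + h) - cz c s) / h) (at_right 0) (locally 0).

Definition C1_at (c : closed_cross_section) (s : R) : Prop :=
  locally s (fun u => ex_derive (cx c) u /\ ex_derive (cz c) u) /\
  continuous (Derive (cx c)) s /\ continuous (Derive (cz c)) s.

Definition vertical_tangent (c : closed_cross_section) (s : R) : Prop :=
  is_derive (cx c) s 0.

Definition vertical_line_segment (c : closed_cross_section) (a b : R) : Prop :=
  a < b /\ exists e : R, (e = 1 \/ e = -1) /\
    forall s, a <= s <= b -> cx c s = cx c a /\ cz c s = cz c a + e * (s - a).

Definition maximal_vertical_line_segment
    (c : closed_cross_section) (a b : R) : Prop :=
  vertical_line_segment c a b /\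
  forall a' b', a' <= a -> b <= b' -> vertical_line_segment c a' b' ->
    a' = a /\ b' = b.

Definition break_point (L : R) (n : nat) (p : nat -> R) (s : R) : Prop :=
  exists (i : nat) (k : Z), (i <= n)%nat /\ s = p i + IZR k * L.

Definition admissible_decomposition
    (c : closed_cross_section) (n : nat) (p : nat -> R) : Prop :=
  partition (clen c) n p /\
  (forall s, ~ C1_at c s -> break_point (clen c) n p s) /\
  (forall s, vertical_tangent c s ->
     ~ (exists a b, vertical_line_segment c a b /\ a < s < b) ->
     break_point (clen c) n p s) /\
  (forall a b, maximal_vertical_line_segment c a b ->
     break_point (clen c) n p a /\ break_point (clen c) n p b /\
     forall s, a < s < b -> ~ break_point (clen c) n p s).

Definition arc (c : closed_cross_section) (a b : R) (P : R * R) : Prop :=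
  exists s, a <= s <= b /\ P = (cx c s, cz c s).

Definition related_by (h : R * R -> R * R) (A B : R * R -> Prop) : Prop :=
  exists v : R * R, forall P, A P <-> B (fst (h P) + fst v, snd (h P) + snd v).

Definition same_class (A B : R * R -> Prop) : Prop :=
  related_by (fun P => P) A B \/
  related_by (fun P => (fst P, - snd P)) A B \/
  related_by (fun P => (- fst P, snd P)) A B \/
  related_by (fun P => (- fst P, - snd P)) A B.

(* The sign refers to the direction of the parametrization. Reversing it changes
   every sign, so sums vanish for the counter-clockwise sweep iff they vanish
   for the clockwise one, and no orientation is imposed.
   The value 0 is not taken on an arc that is strictly monotone. *)
Definition arc_sign (c : closed_cross_section) (a b : R) : Z :=
  if excluded_middle_informative
       (forall s u, a <= s -> s < u -> u <= b -> cz c s < cz c u) then 1%Z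
  else if excluded_middle_informative
       (forall s u, a <= s -> s < u -> u <= b -> cz c u < cz c s) then (-1)%Z
  else 0%Z.

Definition class_sign_sum
    (c : closed_cross_section) (n : nat) (p : nat -> R) (i : nat) : Z :=
  fold_right Z.add 0%Z
    (List.map (fun j =>
       if excluded_middle_informative
            (same_class (arc c (p i) (p (S i))) (arc c (p j) (p (S j))))
       then arc_sign c (p j) (p (S j)) else 0%Z)
     (List.seq 0 n)).

Definition radicand (c : closed_cross_section) (t s : R) : R :=
  (1 - t ^ 2) * (Derive (cx c) s) ^ 2 + (Derive (cz c) s) ^ 2.

(* T-type deformation of the arc that starts at parameter [a], moved to the
   origin. On a C^1 arc without horizontal tangent, [sign (Derive (cz c) u)] is
   constant in [u]; values of [Derive] at the end points do not matter. *)
Definition deformed_arc (c : closed_cross_section) (t a s : R) : R * R :=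
  (t * (cx c s - cx c a),
   RInt (fun u => sign (Derive (cz c) u) * sqrt (radicand c t u)) a s).

Fixpoint deformed_vertex (c : closed_cross_section) (t : R) (i : nat) : R * R :=
  match i with
  | O => (0, 0)
  | S j =>
      let P := deformed_vertex c t j in
      let Q := deformed_arc c t (cbrk c j) (cbrk c (S j)) in
      (fst P + fst Q, snd P + snd Q)
  end.

Definition admissible_parameter (c : closed_cross_section) (t : R) : Prop :=
  forall i s, (i < cnum c)%nat -> cbrk c i < s < cbrk c (S i) ->
    0 <= radicand c t s.

Definition compatible (c : closed_cross_section) : Prop :=
  forall t, admissible_parameter c t ->
    deformed_vertex c t (cnum c) = deformed_vertex c t 0.

(* Main.v *)
From Stdlib Require Import Reals ZArith List Lra Lia Ranalysis5 ClassicalEpsilon.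
From Coquelicot Require Import Coquelicot.
Require Import Defs.
Local Open Scope R_scope.

(** Along a closed curve the deformed [x]-coordinate is [t] times the original
    one, so it always closes up; only the height matters. The height gained on
    an arc is the integral of [height_rate], a function with the period of the
    curve. Hence the total height gain can be computed on the arcs of the
    admissible decomposition instead of the given smooth pieces
    ([deformed_vertex_closed_form], [periodic_RInt], [RInt_partition]).

    Inside an arc of an admissible decomposition the curve is [C^1] and has no
    horizontal tangent, so the slope of the height keeps a sign [e], which is
    the [arc_sign] of the arc, and the height gain is [e] times the unsigned
    rise, the integral of [rise_rate] ([RInt_height_rate_monotone_arc]).

    The unsigned rise depends only on the class of the arc
    ([same_class_rise]). Classes are defined by images, so the key point is
    that two arcs with the same image have essentially the same
    parametrization. After reversal both rise; a rising arc is the graph of a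
    function of the height, so matching points of equal height defines a
    reparametrization [w] between them, and as both arcs have unit speed
    [w' = 1] ([rising_arc_shift]). The symmetries change [x'] and [z'] only by
    signs, and [rise_rate] contains only their squares.

    The total height gain is therefore the sum of sign times rise over the
    arcs; the rise is constant on each class and the signs of each class cancel
    ([class_cancellation]). *)

(** * Functions of one real variable *)

Lemma locally_between (a b s : R) : a < s < b -> locally s (fun r => a < r < b).
Proof.
  intros Hs. apply (locally_interval _ s a b); simpl; [lra|lra|].
  intros y H1 H2. auto.
Qed.

(** Differentiability is asked inside the interval only, since the height along an
    arc need not be differentiable at the break points. *)
Lemma increasing_inverse_derive (f : R -> R) (c d : R) :
  c < d ->
  (forall s, continuous f s) ->
  (forall s u, c <= s -> s < u -> u <= d -> f s < f u) ->
  (forall s, c < s < d -> ex_derive f s /\ Derive f s <> 0) ->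
  exists g : R -> R,
    (forall s, c <= s <= d -> g (f s) = s) /\
    (forall s, c < s < d -> is_derive g (f s) (/ Derive f s)).
Proof.
  intros Hcd Hcont Hinc Hder.
  assert (Hcp : forall s, continuity_pt f s).
  { intros s. apply continuity_pt_filterlim. apply Hcont. }
  assert (Hpre : forall y, exists u, f c <= y <= f d -> c <= u <= d /\ f u = y).
  { intros y. destruct (Rle_dec (f c) y) as [H1|H1]; [|exists c; lra].
    destruct (Rle_dec y (f d)) as [H2|H2]; [|exists c; lra].
    destruct (IVT_gen f c d y) as [u [Hu1 Hu2]].
    - exact Hcp.
    - rewrite Rmin_left, Rmax_right by lra. lra.
    - rewrite Rmin_left, Rmax_right in Hu1 by lra. exists u. intros _. split; assumption. }
  set (g := fun y => proj1_sig (constructive_indefinite_description _ (Hpre y))).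
  assert (Hg : forall y, f c <= y <= f d -> c <= g y <= d /\ f (g y) = y).
  { intros y. unfold g. apply proj2_sig. }
  assert (Hle : forall s u, c <= s -> s <= u -> u <= d -> f s <= f u).
  { intros s u H1 [H2|H2] H3; [left; apply Hinc; assumption | subst; lra]. }
  assert (Hgf : forall s, c <= s <= d -> g (f s) = s).
  { intros s Hs. destruct (Hg (f s)) as [Hr He].
    - split; apply Hle; lra.
    - destruct (Rtotal_order (g (f s)) s) as [H|[H|H]]; [|exact H|].
      + apply (Hinc _ s) in H; lra.
      + apply (Hinc s) in H; lra. }
  exists g. split; [exact Hgf|].
  intros s Hs.
  (* The inverse function theorem asks for derivability on a closed interval, so
     [c, d] is shrunk around [s]. *)
  set (c' := (c + s) / 2). set (d' := (s + d) / 2).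
  assert (Hc' : c < c' < s) by (unfold c'; lra).
  assert (Hd' : s < d' < d) by (unfold d'; lra).
  assert (Hd : forall a, g (f c') <= a <= g (f d') -> derivable_pt f a).
  { rewrite !Hgf by lra. intros a Ha. apply ex_derive_Reals_0. apply Hder. lra. }
  assert (Hin : g (f c') <= g (f s) <= g (f d')) by (rewrite !Hgf; lra).
  assert (Hval : derive_pt f (g (f s)) (Hd (g (f s)) Hin) = Derive f s).
  { rewrite (Derive_Reals f (g (f s))). rewrite Hgf by lra. reflexivity. }
  apply is_derive_Reals. replace (/ Derive f s) with (1 / derive_pt f (g (f s)) (Hd (g (f s)) Hin))
    by (rewrite Hval; unfold Rdiv; ring).
  apply derivable_pt_lim_recip_interv with (lb := f c') (ub := f d').
  - apply (continuity_pt_recip_interv f g c d); try assumption.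
    + intros x H1 H2. apply (Hg x). lra.
    + intros x H1 H2. apply (Hg x). lra.
    + intros a _. apply Hcp.
    + split; apply Hinc; lra.
  - apply Hinc; lra.
  - split; apply Hinc; lra.
  - intros x Hx. apply (Hg x).
    assert (f c < f c') by (apply Hinc; lra). assert (f d' < f d) by (apply Hinc; lra). lra.
  - rewrite Hval. apply Hder. exact Hs.
Qed.

Lemma increasing_of_slope (f : R -> R) (a b : R) :
  (forall s, continuous f s) ->
  (forall s, a < s < b -> ex_derive f s /\ 0 < Derive f s) ->
  forall s u, a <= s -> s < u -> u <= b -> f s < f u.
Proof.
  intros Hc Hd s u H1 H2 H3.
  assert (pr : forall r, s < r < u -> derivable_pt f r).
  { intros r Hr. apply ex_derive_Reals_0, Hd. lra. }
  destruct (MVT f id s u pr (fun r _ => derivable_pt_id r) H2) as [r [Hr He]].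
  - intros r _. apply continuity_pt_filterlim, Hc.
  - intros r _. apply derivable_continuous, derivable_id.
  - rewrite (Derive_Reals f), derive_pt_id in He. unfold id in He.
    assert (0 < Derive f r) by (apply Hd; lra).
    assert (0 < (u - s) * Derive f r) by (apply Rmult_lt_0_compat; lra). lra.
Qed.

Lemma constant_sign (f : R -> R) (a b : R) :
  a < b -> (forall s, a < s < b -> continuous f s /\ f s <> 0) ->
  exists e, (e = 1 \/ e = -1) /\ forall s, a < s < b -> 0 < e * f s.
Proof.
  intros Hab Hf.
  assert (Hpos : forall s u, a < s < b -> a < u < b -> s < u -> 0 < f s * f u).
  { intros s u Hs Hu Hsu.
    assert (Hno : forall h : R -> R, (forall r, a < r < b -> continuous h r /\ h r <> 0) ->
      h s < 0 -> 0 < h u -> False).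
    { intros h Hh H1 H2. destruct (IVT_interv h s u) as [r [Hr E]]; try assumption.
      - intros r Hr. apply continuity_pt_filterlim, Hh. lra.
      - apply (proj2 (Hh r ltac:(lra))), E. }
    destruct (Rtotal_order (f s) 0) as [H1|[H1|H1]]; [|elim (proj2 (Hf s Hs)); exact H1|];
    (destruct (Rtotal_order (f u) 0) as [H2|[H2|H2]]; [|elim (proj2 (Hf u Hu)); exact H2|]).
    - nra.
    - contradiction (Hno f Hf H1 H2).
    - exfalso. apply (Hno (fun r => - f r)); [|lra|lra].
      intros r Hr. destruct (Hf r Hr). split; [apply (continuous_opp f); assumption|lra].
    - nra. }
  set (m := (a + b) / 2). assert (Hm : a < m < b) by (unfold m; lra).
  assert (Hall : forall s, a < s < b -> 0 < f m * f s).
  { intros s Hs. pose proof (proj2 (Hf m Hm)). destruct (Rtotal_order s m) as [H1|[->|H1]].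
    - rewrite Rmult_comm. apply Hpos; assumption.
    - nra.
    - apply Hpos; assumption. }
  destruct (Rtotal_order (f m) 0) as [H|[H|H]].
  - exists (-1). split; [auto|]. intros s Hs. specialize (Hall s Hs). nra.
  - elim (proj2 (Hf m Hm)). exact H.
  - exists 1. split; [auto|]. intros s Hs. specialize (Hall s Hs). nra.
Qed.

Lemma sign_of_slope (e d : R) : e = 1 \/ e = -1 -> 0 < e * d -> sign d = e.
Proof.
  intros [-> | ->] H; [apply sign_eq_1 | apply sign_eq_m1]; lra.
Qed.

Lemma Derive_reverse (f : R -> R) (s : R) :
  ex_derive f (- s) ->
  ex_derive (fun r => f (- r)) s /\ Derive (fun r => f (- r)) s = - Derive f (- s).
Proof.
  intros H.
  assert (D : is_derive (fun r => f (- r)) s (- Derive f (- s))).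
  { replace (- Derive f (- s)) with (scal (- 1) (Derive f (- s)))
      by (change (- 1 * Derive f (- s) = - Derive f (- s)); ring).
    apply (is_derive_comp f (fun r => - r)).
    - apply Derive_correct, H.
    - auto_derive; [exact I | ring]. }
  split; [eexists; exact D | apply is_derive_unique, D].
Qed.

Lemma Derive_affine (f : R -> R) (k v s : R) :
  ex_derive f s ->
  ex_derive (fun r => k * f r + v) s /\ Derive (fun r => k * f r + v) s = k * Derive f s.
Proof.
  intros H.
  assert (D : is_derive (fun r => k * f r + v) s (k * Derive f s)).
  { rewrite <- (Rplus_0_r (k * Derive f s)).
    apply (is_derive_plus (fun r => k * f r) (fun _ => v)).
    - apply (is_derive_scal f s k), Derive_correct, H.
    - apply (is_derive_const (K := R_AbsRing) v). }
  split; [eexists; exact D | apply is_derive_unique, D].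
Qed.

Lemma RInt_shift (f : R -> R) (k a b : R) :
  ex_RInt f (a + k) (b + k) ->
  ex_RInt (fun s => f (s + k)) a b /\
  RInt (fun s => f (s + k)) a b = RInt f (a + k) (b + k).
Proof.
  intros H.
  assert (H' : ex_RInt f (1 * a + k) (1 * b + k)) by (rewrite !Rmult_1_l; exact H).
  assert (He : forall s, scal 1 (f (1 * s + k)) = f (s + k)).
  { intros s. rewrite (Rmult_1_l s). apply (Rmult_1_l (f (s + k))). }
  split.
  - apply (ex_RInt_ext (fun s => scal 1 (f (1 * s + k)))); [intros; apply He|].
    apply (ex_RInt_comp_lin f 1 k a b), H'.
  - rewrite <- (RInt_ext (fun s => scal 1 (f (1 * s + k)))) by (intros; apply He).
    etransitivity; [exact (RInt_comp_lin f 1 k a b H')|].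
    rewrite !Rmult_1_l. reflexivity.
Qed.

Lemma RInt_reverse (f : R -> R) (a b : R) :
  ex_RInt f a b ->
  ex_RInt (fun s => f (- s)) (- b) (- a) /\
  RInt (fun s => f (- s)) (- b) (- a) = RInt f a b.
Proof.
  intros H. apply ex_RInt_swap in H.
  assert (H' : ex_RInt f (-1 * - b + 0) (-1 * - a + 0)).
  { replace (-1 * - b + 0) with b by ring. replace (-1 * - a + 0) with a by ring. exact H. }
  assert (He : forall s, scal (-1) (scal (-1) (f (-1 * s + 0))) = f (- s)).
  { intros s. replace (-1 * s + 0) with (- s) by ring.
    change (-1 * (-1 * f (- s)) = f (- s)). ring. }
  pose proof (ex_RInt_comp_lin f (-1) 0 (- b) (- a) H') as Hex.
  split.
  - apply (ex_RInt_ext (fun s => scal (-1) (scal (-1) (f (-1 * s + 0))))); [intros; apply He|].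
    apply (ex_RInt_scal (V := R_NormedModule)), Hex.
  - rewrite <- (RInt_ext (fun s => scal (-1) (scal (-1) (f (-1 * s + 0))))) by (intros; apply He).
    etransitivity; [exact (RInt_scal _ _ _ (-1) Hex)|].
    etransitivity; [exact (f_equal (scal (-1)) (RInt_comp_lin f (-1) 0 (- b) (- a) H'))|].
    replace (-1 * - b + 0) with b by ring. replace (-1 * - a + 0) with a by ring.
    rewrite <- (opp_RInt_swap f b a H).
    change (-1 * RInt f b a = - RInt f b a). ring.
Qed.

(** * Monotone arcs and their parametrizations *)

(** The properties of the arcs of an admissible decomposition from which the rise is
    determined; [e = 1] for a rising and [e = -1] for a falling arc. The height is
    continuous on the whole line so that the end points of the arc need no
    one-sided notions. *)
Record monotone_arc (e : R) (x z : R -> R) (a b : R) : Prop := MonotoneArc {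
  arc_nontrivial : a < b;
  arc_height_continuous : forall s, continuous z s;
  arc_differentiable : forall s, a < s < b -> ex_derive x s /\ ex_derive z s;
  arc_unit_speed : forall s, a < s < b -> (Derive x s) ^ 2 + (Derive z s) ^ 2 = 1;
  arc_slope : forall s, a < s < b -> 0 < e * Derive z s
}.

Lemma arc_height_increasing (x z : R -> R) (a b : R) :
  monotone_arc 1 x z a b ->
  forall s u, a <= s -> s < u -> u <= b -> z s < z u.
Proof.
  intros [_ Hc Hd _ Hs]. apply increasing_of_slope; [exact Hc|].
  intros s H. split; [apply Hd, H|]. specialize (Hs s H). lra.
Qed.

Definition curve_image (x z : R -> R) (a b : R) (P : R * R) : Prop :=
  exists s, a <= s <= b /\ P = (x s, z s).

(** Let [g] be the inverse of the height of the second arc. Then [w = g o z1] sends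
    a point of the first arc to the parameter of the same point on the second
    one. From [x1 = x2 o w] and [z1 = z2 o w] and the unit speeds, [w'^2 = 1], and
    [w' > 0] because both heights rise. So [w] is a shift. *)
Lemma rising_arc_shift (x1 z1 x2 z2 : R -> R) (a b c d : R) :
  monotone_arc 1 x1 z1 a b -> monotone_arc 1 x2 z2 c d ->
  (forall P, curve_image x1 z1 a b P -> curve_image x2 z2 c d P) ->
  exists k, c <= a + k /\ b + k <= d /\
    forall s, a < s < b -> x1 s = x2 (s + k) /\ z1 s = z2 (s + k).
Proof.
  intros A1 A2 Himg.
  pose proof (arc_height_increasing _ _ _ _ A1) as Hinc1.
  pose proof (arc_height_increasing _ _ _ _ A2) as Hinc2.
  destruct A1 as [Hab Hc1 Hd1 Hu1 Hs1]. destruct A2 as [Hcd Hc2 Hd2 Hu2 Hs2].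
  destruct (increasing_inverse_derive z2 c d Hcd Hc2 Hinc2) as [g [Hg Hdg]].
  { intros s Hs. split; [apply Hd2, Hs|]. specialize (Hs2 s Hs). lra. }
  set (w := fun s => g (z1 s)).
  assert (Hw : forall s, a <= s <= b -> c <= w s <= d /\ x2 (w s) = x1 s /\ z2 (w s) = z1 s).
  { intros s Hs. destruct (Himg (x1 s, z1 s)) as [u [Hu He]]; [exists s; auto|].
    injection He as Ex Ez.
    assert (Hwu : w s = u) by (unfold w; rewrite Ez; apply Hg, Hu).
    rewrite Hwu. auto. }
  assert (Hwint : forall s, a < s < b -> c < w s < d).
  { intros s Hs. destruct (Hw a) as [Ha [_ Ea]]; [lra|].
    destruct (Hw b) as [Hb [_ Eb]]; [lra|]. destruct (Hw s) as [Hr [_ Es]]; [lra|].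
    assert (z1 a < z1 s) by (apply Hinc1; lra).
    assert (z1 s < z1 b) by (apply Hinc1; lra).
    assert (H4 : z2 c <= z2 (w a)).
    { destruct Ha as [[Ha|Ha] Ha2]; [left; apply Hinc2; lra|rewrite Ha; lra]. }
    assert (H5 : z2 (w b) <= z2 d).
    { destruct Hb as [Hb2 [Hb|Hb]]; [left; apply Hinc2; lra|rewrite Hb; lra]. }
    split.
    - destruct Hr as [[Hr|Hr] _]; [exact Hr|]. rewrite <- Hr in Es. lra.
    - destruct Hr as [_ [Hr|Hr]]; [exact Hr|]. rewrite Hr in Es. lra. }
  assert (Hdw : forall s, a < s < b -> is_derive w s 1).
  { intros s Hs. pose proof (Hwint s Hs) as Hws.
    assert (D : is_derive w s (Derive z1 s * / Derive z2 (w s))).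
    { apply (is_derive_comp g z1 s).
      - rewrite <- (proj2 (proj2 (Hw s ltac:(lra)))). apply Hdg, Hws.
      - apply Derive_correct, Hd1, Hs. }
    pose proof (locally_between a b s Hs) as Hloc.
    assert (Dx : Derive x1 s = Derive w s * Derive x2 (w s)).
    { rewrite <- (Derive_comp x2 w s); [|apply Hd2, Hws|eexists; exact D].
      apply Derive_ext_loc. refine (filter_imp _ _ _ Hloc). intros r Hr. symmetry. apply Hw. lra. }
    assert (Dz : Derive z1 s = Derive w s * Derive z2 (w s)).
    { rewrite <- (Derive_comp z2 w s); [|apply Hd2, Hws|eexists; exact D].
      apply Derive_ext_loc. refine (filter_imp _ _ _ Hloc). intros r Hr. symmetry. apply Hw. lra. }
    pose proof (Hu1 s Hs) as U1. pose proof (Hu2 (w s) Hws) as U2.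
    pose proof (Hs1 s Hs) as S1. pose proof (Hs2 (w s) Hws) as S2.
    assert (Hone : Derive w s = 1).
    { rewrite Dx, Dz in U1. rewrite Dz in S1.
      assert (Hsq : Derive w s * Derive w s = 1) by (rewrite <- U1, <- (Rmult_1_r (_ * _)), <- U2; ring).
      assert (0 < Derive w s) by nra. nra. }
    rewrite <- Hone. apply Derive_correct. eexists; exact D. }
  set (m := (a + b) / 2). exists (w m - m).
  assert (Hconst : forall s, a < s < b -> w s = s + (w m - m)).
  { assert (Haux : forall s u, a < s -> s < u -> u < b -> w s - s = w u - u).
    { intros s u H1 H2 H3. apply (eq_is_derive (fun r => w r - r) s u); [|exact H2].
      intros r Hr. change zero with 0. replace 0 with (1 - 1) by ring.
      apply (is_derive_minus w (fun r => r) r 1 1); [apply Hdw; lra|apply (is_derive_id r)]. }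
    intros s Hs. destruct (Rtotal_order s m) as [H|[H|H]].
    - assert (w s - s = w m - m) by (apply Haux; unfold m in *; lra). lra.
    - subst s. ring.
    - assert (w m - m = w s - s) by (apply Haux; unfold m in *; lra). lra. }
  assert (Hin : forall s, a < s < b -> c < s + (w m - m) < d).
  { intros s Hs. rewrite <- Hconst by exact Hs. apply Hwint, Hs. }
  (* [k] is known to map the open interval into [c, d]; a point close enough to an
     end point would leave it if the closed inequalities failed. *)
  clearbody m. set (k := w m - m) in *. clearbody k.
  repeat split.
  - destruct (Rle_dec c (a + k)) as [H|H]; [exact H|].
    specialize (Hin (Rmin ((a + b) / 2) (a + (c - (a + k)) / 2))).
    unfold Rmin in Hin. destruct (Rle_dec _ _) in Hin; lra.
  - destruct (Rle_dec (b + k) d) as [H|H]; [exact H|].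
    specialize (Hin (Rmax ((a + b) / 2) (b - ((b + k) - d) / 2))).
    unfold Rmax in Hin. destruct (Rle_dec _ _) in Hin; lra.
  - rewrite <- Hconst by assumption. symmetry. apply Hw. lra.
  - rewrite <- Hconst by assumption. symmetry. apply Hw. lra.
Qed.

(** * The rise of an arc under the deformation *)

(** The absolute value of the slope of the deformed height; the square root of
    [radicand], for a curve that need not be closed. *)
Definition rise_rate (t : R) (x z : R -> R) (s : R) : R :=
  sqrt ((1 - t ^ 2) * (Derive x s) ^ 2 + (Derive z s) ^ 2).

(** Each image contains the other, so [rising_arc_shift] bounds each parameter
    interval by the length of the other one; hence the shift carries one interval
    exactly onto the other. *)
Lemma rising_arc_rise (t : R) (x1 z1 x2 z2 : R -> R) (a b c d : R) :
  monotone_arc 1 x1 z1 a b -> monotone_arc 1 x2 z2 c d ->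
  (forall P, curve_image x1 z1 a b P <-> curve_image x2 z2 c d P) ->
  ex_RInt (rise_rate t x2 z2) c d ->
  RInt (rise_rate t x1 z1) a b = RInt (rise_rate t x2 z2) c d.
Proof.
  intros A1 A2 Himg Hex.
  destruct (rising_arc_shift _ _ _ _ _ _ _ _ A1 A2 (fun P => proj1 (Himg P)))
    as [k [K1 [K2 K3]]].
  destruct (rising_arc_shift _ _ _ _ _ _ _ _ A2 A1 (fun P => proj2 (Himg P)))
    as [k' [K1' [K2' _]]].
  assert (Ea : a + k = c) by lra. assert (Eb : b + k = d) by lra.
  pose proof (arc_nontrivial _ _ _ _ _ A1) as Hab.
  rewrite <- Ea, <- Eb in Hex |- *.
  destruct (RInt_shift _ _ _ _ Hex) as [_ <-].
  apply RInt_ext. rewrite Rmin_left, Rmax_right by lra. intros s Hs.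
  pose proof (locally_between a b s Hs) as Hloc.
  assert (HD : forall f, Derive (fun r => f (r + k)) s = Derive f (s + k)).
  { intros f. unfold Derive. f_equal. apply Lim_ext. intros h.
    replace (s + h + k) with (s + k + h) by ring. reflexivity. }
  unfold rise_rate. rewrite <- (HD x2), <- (HD z2).
  rewrite (Derive_ext_loc x1 (fun r => x2 (r + k)) s),
    (Derive_ext_loc z1 (fun r => z2 (r + k)) s); [reflexivity| |];
    refine (filter_imp _ _ _ Hloc); intros r Hr; apply K3, Hr.
Qed.

Lemma reversed_arc (t e : R) (x z : R -> R) (a b : R) :
  monotone_arc e x z a b ->
  monotone_arc (- e) (fun s => x (- s)) (fun s => z (- s)) (- b) (- a) /\
  (forall P, curve_image (fun s => x (- s)) (fun s => z (- s)) (- b) (- a) P <->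
             curve_image x z a b P) /\
  (forall s, - b < s < - a ->
     rise_rate t (fun s => x (- s)) (fun s => z (- s)) s = rise_rate t x z (- s)).
Proof.
  intros [Hab Hc Hd Hu Hs].
  assert (HD : forall s, - b < s < - a ->
    (ex_derive (fun r => x (- r)) s /\ Derive (fun r => x (- r)) s = - Derive x (- s)) /\
    (ex_derive (fun r => z (- r)) s /\ Derive (fun r => z (- r)) s = - Derive z (- s))).
  { intros s H. split; apply Derive_reverse, Hd; lra. }
  split; [|split].
  - constructor.
    + lra.
    + intros s. apply (continuous_comp Ropp z); [|apply Hc].
      apply (continuous_opp (fun r : R => r)), continuous_id.
    + intros s H. split; apply HD, H.
    + intros s H. destruct (HD s H) as [[_ ->] [_ ->]]. rewrite <- (Hu (- s)) by lra. ring.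
    + intros s H. destruct (HD s H) as [_ [_ ->]]. specialize (Hs (- s)).
      replace (- e * - Derive z (- s)) with (e * Derive z (- s)) by ring. apply Hs. lra.
  - intros P. split; intros [s [H ->]].
    + exists (- s). split; [lra|reflexivity].
    + exists (- s). rewrite Ropp_involutive. split; [lra|reflexivity].
  - intros s H. unfold rise_rate. destruct (HD s H) as [[_ ->] [_ ->]].
    f_equal. ring.
Qed.

(** A falling arc run backwards rises, with the same image and the same rise. *)
Lemma rising_reparametrization (t e : R) (x z : R -> R) (a b : R) :
  e = 1 \/ e = -1 -> monotone_arc e x z a b -> ex_RInt (rise_rate t x z) a b ->
  exists x' z' a' b', monotone_arc 1 x' z' a' b' /\
    (forall P, curve_image x' z' a' b' P <-> curve_image x z a b P) /\
    ex_RInt (rise_rate t x' z') a' b' /\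
    RInt (rise_rate t x' z') a' b' = RInt (rise_rate t x z) a b.
Proof.
  intros [-> | ->] A Hex.
  - exists x, z, a, b. split; [exact A|]. split; [|split]; [|exact Hex|reflexivity].
    intros P. reflexivity.
  - destruct (reversed_arc t _ _ _ _ _ A) as [A' [Himg Hspeed]].
    destruct (RInt_reverse _ _ _ Hex) as [Hex' HI].
    pose proof (arc_nontrivial _ _ _ _ _ A) as Hab.
    exists (fun s => x (- s)), (fun s => z (- s)), (- b), (- a).
    split; [|split; [exact Himg|split]].
    + replace 1 with (- -1) by ring. exact A'.
    + apply (ex_RInt_ext (fun s => rise_rate t x z (- s))); [|exact Hex'].
      rewrite Rmin_left, Rmax_right by lra. intros s H. symmetry. apply Hspeed, H.
    + rewrite <- HI. apply RInt_ext.
      rewrite Rmin_left, Rmax_right by lra. intros s H. apply Hspeed, H.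
Qed.

Lemma arc_rise_image (t e1 e2 : R) (x1 z1 x2 z2 : R -> R) (a b c d : R) :
  (e1 = 1 \/ e1 = -1) -> (e2 = 1 \/ e2 = -1) ->
  monotone_arc e1 x1 z1 a b -> monotone_arc e2 x2 z2 c d ->
  ex_RInt (rise_rate t x1 z1) a b -> ex_RInt (rise_rate t x2 z2) c d ->
  (forall P, curve_image x1 z1 a b P <-> curve_image x2 z2 c d P) ->
  RInt (rise_rate t x1 z1) a b = RInt (rise_rate t x2 z2) c d.
Proof.
  intros E1 E2 A1 A2 X1 X2 Himg.
  destruct (rising_reparametrization t _ _ _ _ _ E1 A1 X1)
    as [x1' [z1' [a' [b' [A1' [I1 [_ <-]]]]]]].
  destruct (rising_reparametrization t _ _ _ _ _ E2 A2 X2)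
    as [x2' [z2' [c' [d' [A2' [I2 [X2' <-]]]]]]].
  apply rising_arc_rise; try assumption.
  intros P. rewrite I1, I2. apply Himg.
Qed.

(** With factors [1] or [-1] the map is a symmetry followed by a translation. The
    derivatives are multiplied by the factors, and speed and rise only depend on
    their squares. *)
Lemma symmetric_arc (t e kx kz vx vz : R) (x z : R -> R) (a b : R) :
  kx ^ 2 = 1 -> kz ^ 2 = 1 -> monotone_arc e x z a b ->
  monotone_arc (kz * e) (fun s => kx * x s + vx) (fun s => kz * z s + vz) a b /\
  (forall s, a < s < b ->
     rise_rate t (fun s => kx * x s + vx) (fun s => kz * z s + vz) s
     = rise_rate t x z s).
Proof.
  intros Kx Kz [Hab Hc Hd Hu Hs].
  assert (HD : forall s, a < s < b ->
    (ex_derive (fun r => kx * x r + vx) s /\ Derive (fun r => kx * x r + vx) s = kx * Derive x s) /\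
    (ex_derive (fun r => kz * z r + vz) s /\ Derive (fun r => kz * z r + vz) s = kz * Derive z s)).
  { intros s H. split; apply Derive_affine, Hd, H. }
  split.
  - constructor.
    + exact Hab.
    + intros s. apply (continuous_plus (fun r => kz * z r) (fun _ => vz)).
      * apply (continuous_scal_r kz z), Hc.
      * apply continuous_const.
    + intros s H. split; apply HD, H.
    + intros s H. destruct (HD s H) as [[_ ->] [_ ->]].
      rewrite !Rpow_mult_distr, Kx, Kz, !Rmult_1_l. apply Hu, H.
    + intros s H. destruct (HD s H) as [_ [_ ->]].
      replace (kz * e * (kz * Derive z s)) with (kz ^ 2 * (e * Derive z s)) by ring.
      rewrite Kz, Rmult_1_l. apply Hs, H.
  - intros s H. unfold rise_rate. destruct (HD s H) as [[_ ->] [_ ->]].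
    rewrite !Rpow_mult_distr, Kx, Kz, !Rmult_1_l. reflexivity.
Qed.

(** * Classes of arcs *)

(** The four ways of being related in one formula, so that composing two of them
    is a computation instead of a case distinction. *)
Lemma same_class_iff (A B : R * R -> Prop) :
  same_class A B <->
  exists kx kz vx vz : R, (kx = 1 \/ kx = -1) /\ (kz = 1 \/ kz = -1) /\
    forall X Z, A (X, Z) <-> B (kx * X + vx, kz * Z + vz).
Proof.
  assert (N : forall r, -1 * r = - r) by (intros r; ring).
  split.
  - intros [[v H]|[[v H]|[[v H]|[v H]]]];
      [exists 1, 1 | exists 1, (-1) | exists (-1), 1 | exists (-1), (-1)];
      exists (fst v), (snd v); (split; [auto|split; [auto|]]); intros X Z;
      rewrite (H (X, Z)); simpl;
      rewrite ?Rmult_1_l, ?N; reflexivity.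
  - intros [kx [kz [vx [vz [[-> | ->] [[-> | ->] H]]]]]];
      [left | right; left | right; right; left | right; right; right];
      exists (vx, vz); intros [X Z]; rewrite H; simpl;
      rewrite ?Rmult_1_l, ?N; reflexivity.
Qed.

Lemma same_class_refl A : same_class A A.
Proof.
  apply same_class_iff. exists 1, 1, 0, 0. split; [auto|split; [auto|]].
  intros X Z. rewrite !Rmult_1_l, !Rplus_0_r. reflexivity.
Qed.

Lemma same_class_sym A B : same_class A B -> same_class B A.
Proof.
  rewrite !same_class_iff. intros [kx [kz [vx [vz [Kx [Kz H]]]]]].
  exists kx, kz, (- kx * vx), (- kz * vz). split; [exact Kx|split; [exact Kz|]].
  intros X Z. rewrite H.
  replace (kx * (kx * X + - kx * vx) + vx) with X by (destruct Kx as [-> | ->]; ring).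
  replace (kz * (kz * Z + - kz * vz) + vz) with Z by (destruct Kz as [-> | ->]; ring).
  reflexivity.
Qed.

Lemma same_class_trans A B C : same_class A B -> same_class B C -> same_class A C.
Proof.
  rewrite !same_class_iff. intros [kx [kz [vx [vz [Kx [Kz H]]]]]] [kx' [kz' [vx' [vz' [Kx' [Kz' H']]]]]].
  exists (kx' * kx), (kz' * kz), (kx' * vx + vx'), (kz' * vz + vz').
  split; [|split].
  - destruct Kx as [-> | ->], Kx' as [-> | ->]; lra.
  - destruct Kz as [-> | ->], Kz' as [-> | ->]; lra.
  - intros X Z. rewrite H, H'.
    replace (kx' * (kx * X + vx) + vx') with (kx' * kx * X + (kx' * vx + vx')) by ring.
    replace (kz' * (kz * Z + vz) + vz') with (kz' * kz * Z + (kz' * vz + vz')) by ring.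
    reflexivity.
Qed.

(** Moving the first arc by the symmetry reduces to equal images. *)
Lemma same_class_rise (t e1 e2 : R) (x1 z1 x2 z2 : R -> R) (a b c d : R) :
  (e1 = 1 \/ e1 = -1) -> (e2 = 1 \/ e2 = -1) ->
  monotone_arc e1 x1 z1 a b -> monotone_arc e2 x2 z2 c d ->
  ex_RInt (rise_rate t x1 z1) a b -> ex_RInt (rise_rate t x2 z2) c d ->
  same_class (curve_image x1 z1 a b) (curve_image x2 z2 c d) ->
  RInt (rise_rate t x1 z1) a b = RInt (rise_rate t x2 z2) c d.
Proof.
  intros E1 E2 A1 A2 X1 X2 H. apply same_class_iff in H.
  destruct H as [kx [kz [vx [vz [Kx [Kz H]]]]]].
  assert (Kx2 : kx ^ 2 = 1) by (destruct Kx as [-> | ->]; ring).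
  assert (Kz2 : kz ^ 2 = 1) by (destruct Kz as [-> | ->]; ring).
  destruct (symmetric_arc t e1 kx kz vx vz x1 z1 a b Kx2 Kz2 A1) as [A1' Hsp].
  pose proof (arc_nontrivial _ _ _ _ _ A1) as Hab.
  assert (Hext : forall s, Rmin a b < s < Rmax a b -> rise_rate t x1 z1 s =
     rise_rate t (fun s => kx * x1 s + vx) (fun s => kz * z1 s + vz) s).
  { rewrite Rmin_left, Rmax_right by lra. intros s Hs. symmetry. apply Hsp, Hs. }
  rewrite (RInt_ext _ _ a b Hext).
  apply (arc_rise_image t (kz * e1) e2); try assumption.
  - destruct Kz as [-> | ->], E1 as [-> | ->]; lra.
  - exact (ex_RInt_ext _ _ a b Hext X1).
  - intros [X Z]. split.
    + intros [s [Hs E]]. injection E as -> ->. apply H. exists s. auto.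
    + intros H2.
      assert (HX : X = kx * (kx * (X - vx)) + vx) by (destruct Kx as [-> | ->]; ring).
      assert (HZ : Z = kz * (kz * (Z - vz)) + vz) by (destruct Kz as [-> | ->]; ring).
      rewrite HX, HZ in H2. apply H in H2. destruct H2 as [s [Hs E]].
      injection E as EX EZ. exists s. split; [exact Hs|].
      rewrite <- EX, <- EZ, <- HX, <- HZ. reflexivity.
Qed.

(** By induction on the number of items: the class of the first item contributes
    its common weight times its vanishing sum of signs. Since classes are disjoint
    or equal, deleting that class does not affect the sums of the others. *)
Lemma class_cancellation {T : Type} (rel : T -> T -> Prop) (sg : T -> Z) (w : T -> R) :
  (forall i, rel i i) -> (forall i j, rel i j -> rel j i) ->
  (forall i j k, rel i j -> rel j k -> rel i k) ->
  forall l : list T,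
  (forall i j, In i l -> In j l -> rel i j -> w i = w j) ->
  (forall i, In i l -> fold_right Z.add 0%Z
     (map (fun j => if excluded_middle_informative (rel i j) then sg j else 0%Z) l) = 0%Z) ->
  fold_right Rplus 0 (map (fun j => IZR (sg j) * w j) l) = 0.
Proof.
  intros Hrefl Hsym Htrans l.
  remember (length l) as m eqn:Hm. revert l Hm.
  induction m as [m IH] using lt_wf_ind. intros l Hm Hw Hbal.
  destruct l as [|i l'] eqn:El; [reflexivity|]. rewrite <- El in *.
  assert (Hi : In i l) by (rewrite El; left; reflexivity).
  set (other := fun j => if excluded_middle_informative (rel i j) then false else true).
  assert (Hsplit : forall r, (forall j, In j r -> In j l) ->
    fold_right Rplus 0 (map (fun j => IZR (sg j) * w j) r) =
    w i * IZR (fold_right Z.add 0%Z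
      (map (fun j => if excluded_middle_informative (rel i j) then sg j else 0%Z) r)) +
    fold_right Rplus 0 (map (fun j => IZR (sg j) * w j) (filter other r))).
  { induction r as [|j r IHr]; intros Hr; simpl; [ring|].
    rewrite IHr by (intros k Hk; apply Hr; right; exact Hk). rewrite plus_IZR.
    unfold other at 2. destruct (excluded_middle_informative (rel i j)) as [Hij|Hij]; simpl.
    - rewrite (Hw i j Hi (Hr j (or_introl eq_refl)) Hij). ring.
    - ring. }
  rewrite (Hsplit l (fun _ H => H)), (Hbal i Hi), Rmult_0_r, Rplus_0_l.
  apply (IH (length (filter other l))); [| reflexivity | | ].
  - rewrite Hm, El. simpl. unfold other at 1.
    destruct (excluded_middle_informative (rel i i)) as [_|H]; [|contradiction (H (Hrefl i))].
    pose proof (filter_length_le other l'). lia.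
  - intros j k Hj Hk. apply filter_In in Hj, Hk. apply Hw; [apply Hj | apply Hk].
  - intros k Hk. apply filter_In in Hk. destruct Hk as [Hk Hik].
    refine (eq_trans _ (Hbal k Hk)). clear - Hik Hsym Htrans.
    induction l as [|j l IHl]; [reflexivity|]. simpl.
    unfold other at 1. destruct (excluded_middle_informative (rel i j)) as [Hij|Hij]; simpl.
    + destruct (excluded_middle_informative (rel k j)) as [Hkj|Hkj]; [|rewrite IHl; reflexivity].
      unfold other in Hik. destruct (excluded_middle_informative (rel i k)) as [H|H]; [discriminate|].
      contradiction (H (Htrans _ _ _ Hij (Hsym _ _ Hkj))).
    + rewrite IHl. reflexivity.
Qed.

(** * Periodic functions and partitions of a period *)

Lemma periodic_multiple (f : R -> R) (L : R) :
  (forall s, f (s + L) = f s) -> forall (k : Z) s, f (s + IZR k * L) = f s.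
Proof.
  intros Hp.
  assert (Hn : forall (m : nat) s, f (s + INR m * L) = f s).
  { induction m as [|m IH]; intros s.
    - rewrite Rmult_0_l, Rplus_0_r. reflexivity.
    - rewrite S_INR. replace (s + (INR m + 1) * L) with (s + INR m * L + L) by ring.
      rewrite Hp. apply IH. }
  intros k s. destruct (Z_le_gt_dec 0 k) as [H|H].
  - rewrite <- (Z2Nat.id k H), <- INR_IZR_INZ. apply Hn.
  - rewrite <- (Hn (Z.to_nat (- k)) (s + IZR k * L)).
    rewrite INR_IZR_INZ, Z2Nat.id by lia. rewrite opp_IZR. f_equal. ring.
Qed.

Lemma Derive_periodic (f : R -> R) (L : R) :
  (forall s, f (s + L) = f s) -> forall s, Derive f (s + L) = Derive f s.
Proof.
  intros Hp s. unfold Derive. f_equal. apply Lim_ext. intros h.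
  replace (s + L + h) with (s + h + L) by ring. rewrite !Hp. reflexivity.
Qed.

(** Shifting the period and concatenating gives integrability on symmetric
    intervals around [q], which eventually contain [a] and [b]. *)
Lemma periodic_ex_RInt (f : R -> R) (L q : R) :
  0 < L -> (forall s, f (s + L) = f s) -> ex_RInt f q (q + L) ->
  forall a b, ex_RInt f a b.
Proof.
  intros HL Hp Hex.
  assert (Hshift : forall k : Z, ex_RInt f (q + IZR k * L) (q + L + IZR k * L)).
  { intros k. apply (ex_RInt_ext (fun s => f (s + IZR (- k) * L))).
    - intros s _. apply (periodic_multiple f L Hp).
    - apply RInt_shift. rewrite opp_IZR.
      replace (q + IZR k * L + - IZR k * L) with q by ring.
      replace (q + L + IZR k * L + - IZR k * L) with (q + L) by ring. exact Hex. }
  assert (Hsym : forall m : nat, ex_RInt f (q - INR m * L) (q + INR m * L)).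
  { induction m as [|m IH].
    - rewrite Rmult_0_l, Rminus_0_r, Rplus_0_r. apply ex_RInt_point.
    - apply (ex_RInt_Chasles _ _ (q - INR m * L)).
      + replace (q - INR (S m) * L) with (q + IZR (- Z.of_nat (S m)) * L)
          by (rewrite opp_IZR, <- INR_IZR_INZ; ring).
        replace (q - INR m * L) with (q + L + IZR (- Z.of_nat (S m)) * L)
          by (rewrite opp_IZR, <- INR_IZR_INZ, S_INR; ring).
        apply Hshift.
      + apply (ex_RInt_Chasles _ _ (q + INR m * L)); [exact IH|].
        rewrite S_INR, INR_IZR_INZ.
        replace (q + (IZR (Z.of_nat m) + 1) * L) with (q + L + IZR (Z.of_nat m) * L) by ring.
        apply Hshift. }
  intros a b.
  destruct (INR_unbounded ((Rabs (a - q) + Rabs (b - q)) / L)) as [m Hm].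
  assert (Hm' : Rabs (a - q) + Rabs (b - q) < INR m * L).
  { apply (Rmult_lt_compat_r L) in Hm; [|exact HL].
    unfold Rdiv in Hm. rewrite Rmult_assoc, Rinv_l, Rmult_1_r in Hm by lra. exact Hm. }
  pose proof (Rabs_pos (a - q)). pose proof (Rabs_pos (b - q)).
  apply (ex_RInt_inside f a b q (INR m * L)); [apply Hsym|lra|lra].
Qed.

(** Going from [a] to [b] at the beginning of the period is compensated by going
    from [b + L] to [a + L] at its end. *)
Lemma periodic_RInt (f : R -> R) (L : R) :
  (forall s, f (s + L) = f s) -> (forall a b, ex_RInt f a b) ->
  forall a b, RInt f a (a + L) = RInt f b (b + L).
Proof.
  intros Hp Hex a b.
  rewrite <- (RInt_Chasles f a b (a + L)), <- (RInt_Chasles f b (a + L) (b + L)) by apply Hex.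
  destruct (RInt_shift f L a b (Hex _ _)) as [_ <-].
  rewrite (RInt_ext (fun s => f (s + L)) f) by (intros; apply Hp).
  apply Rplus_comm.
Qed.

Lemma partition_lt (L : R) (n : nat) (p : nat -> R) :
  partition L n p -> forall i j, (i < j)%nat -> (j <= n)%nat -> p i < p j.
Proof.
  intros [_ Hp] i j Hij. induction Hij as [|j Hij IH]; intros Hn.
  - apply Hp. lia.
  - apply Rlt_trans with (p j); [apply IH; lia | apply Hp; lia].
Qed.

Lemma partition_le (L : R) (n : nat) (p : nat -> R) :
  partition L n p -> forall i j, (i <= j)%nat -> (j <= n)%nat -> p i <= p j.
Proof.
  intros Hp i j Hij Hn. destruct (Nat.eq_dec i j) as [->|]; [lra|].
  left. apply (partition_lt L n p Hp); lia.
Qed.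

Lemma partition_locate (L : R) (n : nat) (p : nat -> R) :
  0 < L -> partition L n p ->
  forall s, exists (k : Z) (i : nat), (i < n)%nat /\ p i <= s + IZR k * L < p (S i).
Proof.
  intros HL [Hn Hp] s.
  destruct (base_Int_part ((s - p 0%nat) / L)) as [H1 H2].
  set (m := Int_part ((s - p 0%nat) / L)) in *.
  exists (- m)%Z.
  assert (Hs : p 0%nat <= s + IZR (- m) * L < p n).
  { rewrite Hn, opp_IZR.
    assert (E : s - p 0%nat = (s - p 0%nat) / L * L) by (field; lra).
    split; nra. }
  clear Hn H1 H2. set (r := s + IZR (- m) * L) in *. clearbody r.
  induction n as [|n IH]; [lra|].
  destruct (Rlt_le_dec r (p n)) as [H|H].
  - destruct IH as [i [Hi H']]; [intros i Hi; apply Hp; lia|lra|].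
    exists i. split; [lia|exact H'].
  - exists n. split; [lia|lra].
Qed.

(** The points with [k = 0] are excluded by monotonicity; the other ones lie in
    periods that meet the closed interval from [p 0] to [p n] at most at its end
    points. *)
Lemma partition_interior (L : R) (n : nat) (p : nat -> R) :
  0 < L -> partition L n p ->
  forall i s, (i < n)%nat -> p i < s < p (S i) -> ~ break_point L n p s.
Proof.
  intros HL Hp i s Hi Hs [j [k [Hj E]]].
  pose proof (partition_le L n p Hp 0 j ltac:(lia) Hj).
  pose proof (partition_le L n p Hp j n Hj ltac:(lia)).
  pose proof (partition_le L n p Hp 0 i ltac:(lia) ltac:(lia)).
  pose proof (partition_le L n p Hp (S i) n ltac:(lia) ltac:(lia)).
  pose proof (proj1 Hp) as Hn.
  destruct (Z_lt_le_dec k 0) as [Hk|Hk]; [|destruct (Z_lt_le_dec 0 k) as [Hk'|Hk']].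
  - assert (IZR k <= -1) by (apply IZR_le; lia). nra.
  - assert (1 <= IZR k) by (apply IZR_le; lia). nra.
  - assert (k = 0%Z) as -> by lia. rewrite Rmult_0_l, Rplus_0_r in E. subst s.
    destruct (le_lt_dec j i) as [Hji|Hji].
    + pose proof (partition_le L n p Hp j i Hji ltac:(lia)). lra.
    + pose proof (partition_le L n p Hp (S i) j Hji Hj). lra.
Qed.

Lemma RInt_partition (f : R -> R) (p : nat -> R) :
  (forall a b, ex_RInt f a b) ->
  forall n, RInt f (p 0%nat) (p n) =
    fold_right Rplus 0 (map (fun j => RInt f (p j) (p (S j))) (List.seq 0 n)).
Proof.
  intros Hex n.
  assert (Hgen : forall m, RInt f (p m) (p (m + n)%nat) =
    fold_right Rplus 0 (map (fun j => RInt f (p j) (p (S j))) (List.seq m n))).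
  { induction n as [|n IH]; intros m.
    - rewrite Nat.add_0_r. apply (RInt_point (V := R_CompleteNormedModule)).
    - simpl. rewrite <- IH, Nat.add_succ_r. symmetry.
      apply (RInt_Chasles f); apply Hex. }
  apply (Hgen 0%nat).
Qed.

(** * The cross-section *)

Lemma height_slope_neq_0 (c : closed_cross_section) (s : R) :
  ~ horizontal_tangent c s -> ex_derive (cz c) s -> Derive (cz c) s <> 0.
Proof.
  intros Hh Hex E. apply Hh. left.
  apply Derive_correct in Hex. rewrite E in Hex.
  apply is_derive_Reals in Hex. apply filterlim_locally. intros eps.
  destruct (Hex eps (cond_pos eps)) as [delta Hd].
  exists delta. intros h Hball Hneg. apply Hd; [lra|].
  change (Rabs (h - 0) < delta) in Hball. rewrite Rminus_0_r in Hball. exact Hball.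
Qed.

(** Every parameter is, up to a period, the left end or an inner point of a smooth
    piece. Unit speed right of each point, end points included, is what lets
    continuity supply it at the points where two pieces join smoothly. *)
Lemma unit_speed_after (c : closed_cross_section) (s : R) :
  exists delta, 0 < delta /\ forall u, s < u < s + delta ->
    (Derive (cx c) u) ^ 2 + (Derive (cz c) u) ^ 2 = 1.
Proof.
  destruct (partition_locate _ _ _ (clen_gt0 c) (cbrk_partition c) s) as [k [i [Hi Hs]]].
  exists (cbrk c (S i) - (s + IZR k * clen c)). split; [lra|].
  intros u Hu.
  rewrite <- (periodic_multiple _ _ (Derive_periodic _ _ (cx_periodic c)) k u),
    <- (periodic_multiple _ _ (Derive_periodic _ _ (cz_periodic c)) k u).
  apply (c_arc_length c i); [exact Hi|lra].
Qed.

Lemma unit_speed_of_C1 (c : closed_cross_section) (s : R) :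
  C1_at c s -> (Derive (cx c) s) ^ 2 + (Derive (cz c) s) ^ 2 = 1.
Proof.
  intros [_ [Hx Hz]].
  set (v := fun u => Derive (cx c) u * Derive (cx c) u + Derive (cz c) u * Derive (cz c) u).
  assert (Hv : continuous v s).
  { apply (continuous_plus (fun u => Derive (cx c) u * Derive (cx c) u)
      (fun u => Derive (cz c) u * Derive (cz c) u)).
    - apply (continuous_mult (Derive (cx c)) (Derive (cx c))); exact Hx.
    - apply (continuous_mult (Derive (cz c)) (Derive (cz c))); exact Hz. }
  destruct (unit_speed_after c s) as [delta [Hdelta Hu]].
  destruct (Req_dec (v s) 1) as [H|H]; [unfold v in H; rewrite <- H; ring|].
  exfalso.
  destruct (Hv _ (open_neq 1 (v s) H)) as [eps Heps].
  pose proof (cond_pos eps).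
  set (u := s + Rmin (eps / 2) (delta / 2)).
  assert (0 < Rmin (eps / 2) (delta / 2)) by (apply Rmin_glb_lt; lra).
  pose proof (Rmin_l (eps / 2) (delta / 2)). pose proof (Rmin_r (eps / 2) (delta / 2)).
  apply (Heps u).
  - change (Rabs (u - s) < eps). unfold u. rewrite Rabs_right; lra.
  - unfold v. rewrite <- (Hu u) by (unfold u; lra). ring.
Qed.

(** * Integrating the deformed height *)

Definition height_rate (c : closed_cross_section) (t u : R) : R :=
  sign (Derive (cz c) u) * sqrt (radicand c t u).

Lemma height_rate_periodic (c : closed_cross_section) (t s : R) :
  height_rate c t (s + clen c) = height_rate c t s.
Proof.
  unfold height_rate, radicand.
  rewrite !(Derive_periodic _ _ (cx_periodic c)), !(Derive_periodic _ _ (cz_periodic c)).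
  reflexivity.
Qed.

(** On the open piece the sign factor is constant, and the square root agrees with
    a continuous function on the closed piece because the curve is [C^1] up to the
    end points. *)
Lemma height_rate_arc_integrable (c : closed_cross_section) (t : R) :
  (forall s, ~ horizontal_tangent c s) ->
  forall i, (i < cnum c)%nat -> ex_RInt (height_rate c t) (cbrk c i) (cbrk c (S i)).
Proof.
  intros Hh i Hi.
  pose proof (proj2 (cbrk_partition c) i Hi) as Hlt.
  destruct (c_piecewise_C1 c i Hi) as [[F [HF EF]] [G [HG EG]]].
  set (a := cbrk c i) in *. set (b := cbrk c (S i)) in *.
  pose proof (locally_between a b) as Hloc.
  assert (DF : forall s, a < s < b -> Derive (cx c) s = Derive F s).
  { intros s Hs. apply Derive_ext_loc. refine (filter_imp _ _ _ (Hloc s Hs)).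
    intros r Hr. apply EF. lra. }
  assert (DG : forall s, a < s < b -> ex_derive (cz c) s /\ Derive (cz c) s = Derive G s).
  { intros s Hs.
    assert (HE : locally s (fun r => G r = cz c r)).
    { refine (filter_imp _ _ _ (Hloc s Hs)). intros r Hr. symmetry. apply EG. lra. }
    split.
    - apply (ex_derive_ext_loc G); [exact HE | apply HG].
    - symmetry. apply Derive_ext_loc, HE. }
  destruct (constant_sign (Derive G) a b Hlt) as [e [He Hs]].
  { intros s Hs. split; [apply HG|]. destruct (DG s Hs) as [Hex <-].
    apply height_slope_neq_0; [apply Hh | exact Hex]. }
  apply (ex_RInt_ext (fun s => scal e (sqrt ((1 - t ^ 2) * (Derive F s * Derive F s)
    + Derive G s * Derive G s)))).
  - rewrite Rmin_left, Rmax_right by lra. intros s H. unfold height_rate, radicand.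
    rewrite (DF s H), (proj2 (DG s H)), (sign_of_slope e _ He (Hs s H)).
    change (e * sqrt ((1 - t ^ 2) * (Derive F s * Derive F s) + Derive G s * Derive G s)
      = e * sqrt ((1 - t ^ 2) * Derive F s ^ 2 + Derive G s ^ 2)).
    f_equal. f_equal. ring.
  - apply (ex_RInt_scal (V := R_NormedModule)).
    apply (ex_RInt_continuous (V := R_CompleteNormedModule)). intros s _.
    apply continuous_sqrt_comp.
    apply (continuous_plus (fun s => (1 - t ^ 2) * (Derive F s * Derive F s))
      (fun s => Derive G s * Derive G s)).
    + apply (continuous_scal_r (1 - t ^ 2) (fun s => Derive F s * Derive F s)).
      apply (continuous_mult (Derive F) (Derive F)); apply HF.
    + apply (continuous_mult (Derive G) (Derive G)); apply HG.
Qed.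

Lemma deformed_vertex_closed_form (c : closed_cross_section) (t : R) :
  (forall s, ~ horizontal_tangent c s) ->
  forall i, (i <= cnum c)%nat ->
  ex_RInt (height_rate c t) (cbrk c 0) (cbrk c i) /\
  deformed_vertex c t i =
    (t * (cx c (cbrk c i) - cx c (cbrk c 0)),
     RInt (height_rate c t) (cbrk c 0) (cbrk c i)).
Proof.
  intros Hh i. induction i as [|i IH]; intros Hi.
  - split; [apply ex_RInt_point|].
    rewrite (RInt_point (V := R_CompleteNormedModule)). simpl. apply (f_equal2 pair); [ring|reflexivity].
  - destruct IH as [Hex E]; [lia|].
    pose proof (height_rate_arc_integrable c t Hh i Hi) as Hex'.
    split; [exact (ex_RInt_Chasles _ _ _ _ Hex Hex')|].
    simpl deformed_vertex. rewrite E. unfold deformed_arc. cbv beta zeta. cbn [fst snd]. apply (f_equal2 pair).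
    + ring.
    + exact (RInt_Chasles (height_rate c t) _ _ _ Hex Hex').
Qed.

Lemma height_rate_integrable (c : closed_cross_section) (t : R) :
  (forall s, ~ horizontal_tangent c s) -> forall a b, ex_RInt (height_rate c t) a b.
Proof.
  intros Hh. apply (periodic_ex_RInt _ (clen c) (cbrk c 0) (clen_gt0 c)).
  - apply height_rate_periodic.
  - rewrite <- (proj1 (cbrk_partition c)).
    apply (deformed_vertex_closed_form c t Hh (cnum c)). lia.
Qed.

(** * Arcs of an admissible decomposition *)

(** Inside such an arc the curve is [C^1], and the slope of the height is
    continuous without zeros. *)
Lemma admissible_arc_monotone (c : closed_cross_section) (n : nat) (p : nat -> R) (i : nat) :
  (forall s, ~ horizontal_tangent c s) -> admissible_decomposition c n p -> (i < n)%nat ->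
  exists e, (e = 1 \/ e = -1) /\ monotone_arc e (cx c) (cz c) (p i) (p (S i)).
Proof.
  intros Hh [Hp [HC1 _]] Hi.
  assert (Hsmooth : forall s, p i < s < p (S i) -> C1_at c s).
  { intros s Hs. destruct (excluded_middle_informative (C1_at c s)) as [H|H]; [exact H|].
    contradiction (partition_interior _ _ _ (clen_gt0 c) Hp i s Hi Hs (HC1 s H)). }
  assert (Hder : forall s, p i < s < p (S i) -> ex_derive (cx c) s /\ ex_derive (cz c) s).
  { intros s Hs. exact (locally_singleton _ _ (proj1 (Hsmooth s Hs))). }
  destruct (constant_sign (Derive (cz c)) (p i) (p (S i))) as [e [He Hs]].
  { apply Hp, Hi. }
  { intros s Hs. split; [apply (Hsmooth s Hs)|].
    apply height_slope_neq_0; [apply Hh | apply (Hder s Hs)]. }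
  exists e. split; [exact He|]. constructor.
  - apply Hp, Hi.
  - intros s. apply (c_continuous c s).
  - exact Hder.
  - intros s H. apply unit_speed_of_C1, Hsmooth, H.
  - exact Hs.
Qed.

Lemma monotone_arc_sign (c : closed_cross_section) (e a b : R) :
  e = 1 \/ e = -1 -> monotone_arc e (cx c) (cz c) a b -> IZR (arc_sign c a b) = e.
Proof.
  intros He A. pose proof (arc_nontrivial _ _ _ _ _ A) as Hab. unfold arc_sign.
  destruct He as [-> | ->].
  - pose proof (arc_height_increasing _ _ _ _ A) as Hinc.
    destruct (excluded_middle_informative _) as [_|H]; [reflexivity|contradiction (H Hinc)].
  - assert (Hdec : forall s u, a <= s -> s < u -> u <= b -> cz c u < cz c s).
    { intros s u H1 H2 H3.
      (* Mirror the falling arc to use the statement for rising arcs. *)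
      destruct (symmetric_arc 0 (-1) 1 (-1) 0 0 _ _ _ _ ltac:(ring) ltac:(ring) A) as [A' _].
      replace (-1 * -1) with 1 in A' by ring.
      pose proof (arc_height_increasing _ _ _ _ A' s u H1 H2 H3) as H. simpl in H. lra. }
    destruct (excluded_middle_informative _) as [H|_].
    + exfalso. specialize (H a b). specialize (Hdec a b). lra.
    + destruct (excluded_middle_informative _) as [_|H]; [reflexivity|contradiction (H Hdec)].
Qed.

Lemma RInt_height_rate_monotone_arc (c : closed_cross_section) (t e a b : R) :
  e = 1 \/ e = -1 -> monotone_arc e (cx c) (cz c) a b -> ex_RInt (height_rate c t) a b ->
  ex_RInt (rise_rate t (cx c) (cz c)) a b /\
  RInt (height_rate c t) a b = e * RInt (rise_rate t (cx c) (cz c)) a b.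
Proof.
  intros He A Hex. pose proof (arc_nontrivial _ _ _ _ _ A) as Hab.
  assert (Hrate : forall s, a < s < b ->
    height_rate c t s = e * rise_rate t (cx c) (cz c) s).
  { intros s Hs. unfold height_rate.
    rewrite (sign_of_slope e) by (exact He || apply A, Hs). reflexivity. }
  assert (Hspeed : ex_RInt (rise_rate t (cx c) (cz c)) a b).
  { apply (ex_RInt_ext (fun s => scal e (height_rate c t s))).
    - rewrite Rmin_left, Rmax_right by lra. intros s Hs. rewrite (Hrate s Hs).
      change (e * (e * rise_rate t (cx c) (cz c) s) = rise_rate t (cx c) (cz c) s).
      destruct He as [-> | ->]; ring.
    - apply (ex_RInt_scal (V := R_NormedModule)), Hex. }
  split; [exact Hspeed|].
  transitivity (RInt (fun s => scal e (rise_rate t (cx c) (cz c) s)) a b).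
  - apply RInt_ext. rewrite Rmin_left, Rmax_right by lra. exact Hrate.
  - exact (RInt_scal _ _ _ e Hspeed).
Qed.

(** * Compatibility *)

Theorem theorem4p1 (c : closed_cross_section)
  (no_horizontal_tangent : forall s : R, ~ horizontal_tangent c s)
  (balanced : exists (n : nat) (p : nat -> R),
     admissible_decomposition c n p /\
     forall i : nat, (i < n)%nat -> class_sign_sum c n p i = 0%Z) :
  compatible c.
Proof.
  intros t _. destruct balanced as [n [p [Hadm Hbal]]].
  pose proof (height_rate_integrable c t no_horizontal_tangent) as Hint.
  rewrite (proj2 (deformed_vertex_closed_form c t no_horizontal_tangent (cnum c) (le_n _))).
  rewrite (proj1 (cbrk_partition c)), cx_periodic. simpl. apply (f_equal2 pair); [ring|].
  rewrite (periodic_RInt _ _ (height_rate_periodic c t) Hint _ (p 0%nat)).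
  rewrite <- (proj1 (proj1 Hadm)), (RInt_partition _ p Hint).
  set (rise := fun j => RInt (rise_rate t (cx c) (cz c)) (p j) (p (S j))).
  rewrite (map_ext_in _ (fun j => IZR (arc_sign c (p j) (p (S j))) * rise j)).
  - apply (class_cancellation
      (fun i j => same_class (arc c (p i) (p (S i))) (arc c (p j) (p (S j))))).
    + intros i. apply same_class_refl.
    + intros i j. apply same_class_sym.
    + intros i j k. apply same_class_trans.
    + intros i j Hi Hj Hij. apply in_seq in Hi, Hj.
      destruct (admissible_arc_monotone c n p i no_horizontal_tangent Hadm) as [e [He A]]; [lia|].
      destruct (admissible_arc_monotone c n p j no_horizontal_tangent Hadm) as [e' [He' A']]; [lia|].
      apply (same_class_rise t e e'); try assumption.
      * apply (RInt_height_rate_monotone_arc c t e); auto.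
      * apply (RInt_height_rate_monotone_arc c t e'); auto.
    + intros i Hi. apply in_seq in Hi. apply Hbal. lia.
  - intros j Hj. apply in_seq in Hj.
    destruct (admissible_arc_monotone c n p j no_horizontal_tangent Hadm) as [e [He A]]; [lia|].
    rewrite (monotone_arc_sign c e _ _ He A).
    apply (RInt_height_rate_monotone_arc c t e _ _ He A), Hint.
Qed.
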